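(* Let $c\in[0,1)$, let $d_e(c)=c+\tfrac{\sqrt2}{2}\sqrt{1-c^2}$, and let $d^*(c)$ denote the optimal parameter, i.e. the parameter $d>0$ for which $\max_{t\in[-1,1]}|e_2(t,d)|$ is minimal, where $$e_2(t,d)=1+\frac{\sqrt{1-c^2}\,(c-d)}{\sqrt{\left(1-c^2+(c-d)^2t^2\right)^3}}.$$ (1) If $c\le \tfrac{\sqrt6}{36}\sqrt{181-12\sqrt6}$ (approximately $0.83778$), then $d^*(c)=d_e(c)=c+\tfrac{\sqrt2}{2}\sqrt{1-c^2}$. (2) If $c>\tfrac{\sqrt6}{36}\sqrt{181-12\sqrt6}$, then $d^*(c)$ is the unique solution $d$ of the equation $e_2(1,d)=-e_2(0,d)$ on the interval $[c,d_e(c)]$.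
   Context: Here $c=\cos\varphi$ with $\varphi\in(0,\tfrac\pi2]$, and the unit circular arc $\alpha\mapsto(\cos\alpha,\sin\alpha)^T$, $\alpha\in[-\varphi,\varphi]$, is approximated by the quadratic polynomial curve $p:[-1,1]\to\mathbb{R}^2$, $p(t)=\sum_{j=0}^2\binom2j\left(\tfrac{1+t}{2}\right)^j\left(\tfrac{1-t}{2}\right)^{2-j}b_j$, with control points $b_0=(c,-\sqrt{1-c^2})^T$, $b_1=(d,0)^T$, $b_2=(c,\sqrt{1-c^2})^T$, where $d>0$ is a free parameter ($G^0$ interpolation of the endpoints of the arc). The function $e_2(\cdot,d)=1-\dfrac{p'\times p''}{\|p'\|^3}$ is the signed curvature error of $p$ (the curvature of the unit circle being $1$), given explicitly by the formula in the claim. *)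

(* Defs.v *)
From Stdlib Require Import Reals.
From Coquelicot Require Import Coquelicot.
Open Scope R_scope.

Definition cross (u v : R * R) : R := fst u * snd v - snd u * fst v.

Definition deriv2 (f : R -> R * R) (t : R) : R * R :=
  (Derive (fun x => fst (f x)) t, Derive (fun x => snd (f x)) t).

(** Indices [j > 2] never occur in [curve]; they fall into the last case. *)
Definition control_point (c d : R) (j : nat) : R * R :=
  match j with
  | 0%nat => (c, - sqrt (1 - c ^ 2))
  | 1%nat => (d, 0)
  | _ => (c, sqrt (1 - c ^ 2))
  end.

(** The polynomial is defined on all of [R], so that two-sided derivatives
    make sense at the endpoints of [[-1, 1]].  [sum_n _ 2] has the three terms
    [j = 0, 1, 2]; [Binomial.C] is qualified because [Coquelicot] uses [C] for
    the complex numbers. *)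
Definition curve (c d t : R) : R * R :=
  sum_n (fun j : nat =>
    scal (Binomial.C 2 j * ((1 + t) / 2) ^ j * ((1 - t) / 2) ^ (2 - j))
         (control_point c d j)) 2.

(** [norm] on [R * R] is Coquelicot's product norm, which is Euclidean. *)
Definition e2 (c t d : R) : R :=
  let p' := deriv2 (curve c d) in
  let p'' := deriv2 p' in
  1 - cross (p' t) (p'' t) / norm (p' t) ^ 3.

Definition is_max_on (f : R -> R) (a b M : R) : Prop :=
  (exists t, a <= t <= b /\ f t = M) /\
  (forall t, a <= t <= b -> f t <= M).

Definition is_max_error (c d M : R) : Prop :=
  is_max_on (fun t => Rabs (e2 c t d)) (-1) 1 M.

Definition optimal_parameter (c d : R) : Prop :=
  0 < d /\
  exists M, is_max_error c d M /\
    forall d', 0 < d' -> exists M', is_max_error c d' M' /\ M <= M'.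

Definition d_e (c : R) : R := c + sqrt 2 / 2 * sqrt (1 - c ^ 2).

Definition c_crit : R := sqrt 6 / 36 * sqrt (181 - 12 * sqrt 6).

Definition balanced (c d : R) : Prop :=
  c <= d <= d_e c /\ e2 c 1 d = - e2 c 0 d.

(* Main.v *)
(** Put [s = sqrt (1 - c^2)] and [d = c + s y].  Then
    [e2 c t d = 1 - y / (s (1 + y^2 t^2)^(3/2))] is monotone in [t^2], so
    [|e2|] is largest at [t = 0] or [t = 1].  For [y >= 0] the maximal error is
    the larger of [y/s - 1], which increases with [y], and [1 - g(y)/s] with
    [g(y) = y / (1 + y^2)^(3/2)], which decreases strictly up to its unique
    minimum at [y = sqrt 2 / 2], that is [d = d_e c].  For [y <= 0] the error is
    at least [1].  Hence the minimum lies at [d_e c] as long as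
    [1 - g(y)/s] is still the larger one there, which means [c <= c_crit], and
    otherwise at the point where the two branches cross. *)
Require Import Defs.
From Stdlib Require Import Reals Lra.
From Coquelicot Require Import Coquelicot.
Open Scope R_scope.

(** * Derivatives of the curve and the explicit curvature error *)

Lemma curve_fst (c d t : R) :
  fst (curve c d t) = c * (1 + t ^ 2) / 2 + d * (1 - t ^ 2) / 2.
Proof.
unfold curve; rewrite !sum_Sn, sum_O; simpl.
unfold plus, scal, Binomial.C; simpl; unfold plus, mult; simpl; unfold mult; simpl.
field.
Qed.

Lemma curve_snd (c d t : R) : snd (curve c d t) = sqrt (1 - c ^ 2) * t.
Proof.
unfold curve; rewrite !sum_Sn, sum_O; simpl.
unfold plus, scal, Binomial.C; simpl; unfold plus, mult; simpl; unfold mult; simpl.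
field.
Qed.

Lemma deriv2_curve (c d t : R) :
  deriv2 (curve c d) t = ((c - d) * t, sqrt (1 - c ^ 2)).
Proof.
unfold deriv2; f_equal.
- rewrite (Derive_ext _ _ t (curve_fst c d)).
  apply is_derive_unique; auto_derive; [easy | field].
- rewrite (Derive_ext _ _ t (curve_snd c d)).
  rewrite Derive_scal, Derive_id; ring.
Qed.

Lemma deriv2_deriv2_curve (c d t : R) :
  deriv2 (deriv2 (curve c d)) t = (c - d, 0).
Proof.
unfold deriv2 at 1; f_equal.
- rewrite (Derive_ext _ (fun x => (c - d) * x)).
  + apply is_derive_unique; auto_derive; [easy | ring].
  + intros x; now rewrite deriv2_curve.
- rewrite (Derive_ext _ (fun x => sqrt (1 - c ^ 2))).
  + apply Derive_const.
  + intros x; now rewrite deriv2_curve.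
Qed.

Lemma sqrt_cube (x : R) : 0 <= x -> sqrt (x ^ 3) = sqrt x ^ 3.
Proof.
intros Hx.
replace (x ^ 3) with (x ^ 2 * x) by ring.
rewrite sqrt_mult, sqrt_pow2 by nra.
rewrite <- (pow2_sqrt x Hx) at 1; ring.
Qed.

Lemma e2_explicit (c d t : R) : 0 <= 1 - c ^ 2 ->
  e2 c t d = 1 + sqrt (1 - c ^ 2) * (c - d)
                 / sqrt ((1 - c ^ 2 + (c - d) ^ 2 * t ^ 2) ^ 3).
Proof.
intros Hc; unfold e2; cbv zeta.
rewrite deriv2_curve, deriv2_deriv2_curve.
assert (Hn : norm ((c - d) * t, sqrt (1 - c ^ 2))
             = sqrt (1 - c ^ 2 + (c - d) ^ 2 * t ^ 2)).
{ unfold norm; simpl; unfold prod_norm, norm; simpl; unfold abs; simpl.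
  f_equal.
  rewrite !Rmult_1_r, <- !Rabs_mult, !Rabs_pos_eq by apply Rle_0_sqr.
  rewrite sqrt_sqrt by (simpl in Hc; lra); ring. }
rewrite Hn, sqrt_cube by (assert (H := pow2_ge_0 ((c - d) * t)); nra).
unfold cross; simpl; unfold Rdiv; ring.
Qed.

(** * Rescaled parameter [y] and the maximum over [t] *)

Definition kappa (y : R) : R := y / sqrt ((1 + y ^ 2) ^ 3).

Lemma cube_pos (y : R) : 0 < (1 + y ^ 2) ^ 3.
Proof. apply pow_lt; nra. Qed.

(** With [s = sqrt (1 - c ^ 2)], factoring [s ^ 2] out of the radicand puts [s ^ 3] below a
    numerator [- s ^ 2 * y]. At [t = 1] this leaves [1 - kappa y / s]. *)
Lemma e2_scaled (c t y : R) : 0 < 1 - c ^ 2 ->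
  e2 c t (c + sqrt (1 - c ^ 2) * y)
  = 1 - y / sqrt ((1 + (y * t) ^ 2) ^ 3) / sqrt (1 - c ^ 2).
Proof.
intros Hc; rewrite e2_explicit by lra.
assert (Hs := sqrt_lt_R0 _ Hc).
set (s := sqrt (1 - c ^ 2)) in *.
assert (Hs2 : 1 - c ^ 2 = s ^ 2) by (unfold s; rewrite pow2_sqrt; lra).
rewrite Hs2.
replace (s ^ 2 + (c - (c + s * y)) ^ 2 * t ^ 2)
  with (s ^ 2 * (1 + (y * t) ^ 2)) by ring.
rewrite Rpow_mult_distr, sqrt_mult_alt by (apply pow_le; nra).
rewrite (sqrt_cube (s ^ 2)), sqrt_pow2 by nra.
assert (H := sqrt_lt_R0 _ (cube_pos (y * t))).
field; lra.
Qed.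

(** The two entries are the absolute errors at [t = 0] and [t = 1]. *)
Definition max_error (s y : R) : R :=
  Rmax (Rabs (1 - y / s)) (Rabs (1 - kappa y / s)).

(** Convexity of [Rabs]. Both orders of [a] and [b] are allowed because the sign of [y] decides
    which of the errors at [t = 0] and [t = 1] is larger. *)
Lemma Rabs_between (a b x : R) :
  a <= x <= b \/ b <= x <= a -> Rabs x <= Rmax (Rabs a) (Rabs b).
Proof.
unfold Rmax; destruct (Rle_dec (Rabs a) (Rabs b)) as [H | H];
  revert H; unfold Rabs; repeat destruct Rcase_abs; lra.
Qed.

Lemma is_max_error_scaled (c y : R) : 0 < 1 - c ^ 2 ->
  is_max_error c (c + sqrt (1 - c ^ 2) * y) (max_error (sqrt (1 - c ^ 2)) y).
Proof.
intros Hc.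
assert (Hs := sqrt_lt_R0 _ Hc).
assert (H0 : e2 c 0 (c + sqrt (1 - c ^ 2) * y) = 1 - y / sqrt (1 - c ^ 2)).
{ rewrite e2_scaled by easy.
  replace ((1 + (y * 0) ^ 2) ^ 3) with 1 by ring; rewrite sqrt_1; field; lra. }
assert (H1 : e2 c 1 (c + sqrt (1 - c ^ 2) * y)
             = 1 - kappa y / sqrt (1 - c ^ 2)).
{ rewrite e2_scaled by easy; unfold kappa; now rewrite Rmult_1_r. }
split.
- unfold max_error, Rmax; destruct Rle_dec.
  + exists 1; rewrite H1; split; [lra | easy].
  + exists 0; rewrite H0; split; [lra | easy].
- intros t Ht; unfold max_error; apply Rabs_between.
  rewrite e2_scaled by easy; unfold kappa.
  set (s := sqrt (1 - c ^ 2)) in *.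
  (* The denominator [a] at [t] lies between 1, its value at [t = 0], and [b], its value at
     [t = 1]. *)
  assert (Hy : (y * t) ^ 2 <= y ^ 2).
  { rewrite Rpow_mult_distr.
    assert (t ^ 2 <= 1) by nra.
    assert (0 <= y ^ 2) by apply pow2_ge_0.
    nra. }
  assert (Ha : 1 <= sqrt ((1 + (y * t) ^ 2) ^ 3)).
  { rewrite <- sqrt_1 at 1; apply sqrt_le_1_alt, pow_R1_Rle.
    assert (0 <= (y * t) ^ 2) by apply pow2_ge_0; lra. }
  assert (Hb : sqrt ((1 + (y * t) ^ 2) ^ 3) <= sqrt ((1 + y ^ 2) ^ 3)).
  { apply sqrt_le_1_alt, pow_incr.
    assert (0 <= (y * t) ^ 2) by apply pow2_ge_0; lra. }
  set (a := sqrt ((1 + (y * t) ^ 2) ^ 3)) in *.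
  set (b := sqrt ((1 + y ^ 2) ^ 3)) in *.
  assert (Hia : / a <= 1) by (rewrite <- Rinv_1; apply Rinv_le_contravar; lra).
  assert (Hib : / b <= / a) by (apply Rinv_le_contravar; lra).
  assert (His : 0 < / s) by now apply Rinv_0_lt_compat.
  unfold Rdiv.
  destruct (Rle_or_lt 0 y) as [H | H]; [left | right].
  + assert (y * / a <= y) by nra.
    assert (y * / b <= y * / a) by nra.
    split; nra.
  + assert (y <= y * / a) by nra.
    assert (y * / a <= y * / b) by nra.
    split; nra.
Qed.

Lemma is_max_error_unique (c d M M' : R) :
  is_max_error c d M -> is_max_error c d M' -> M = M'.
Proof.
intros [[t [Ht Et]] H] [[t' [Ht' Et']] H'].
generalize (H t' Ht') (H' t Ht); cbv beta in *; lra.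
Qed.

(** Since [s > 0], every [d] has the form [c + s * y], so optimality reduces to minimizing
    [max_error] in [y]; strictness gives uniqueness. *)
Lemma optimal_iff_strict_minimizer (c y0 : R) : 0 < 1 - c ^ 2 ->
  0 < c + sqrt (1 - c ^ 2) * y0 ->
  (forall y, y <> y0 ->
     max_error (sqrt (1 - c ^ 2)) y0 < max_error (sqrt (1 - c ^ 2)) y) ->
  forall d, optimal_parameter c d <-> d = c + sqrt (1 - c ^ 2) * y0.
Proof.
intros Hc Hd0 Hmin d.
assert (Hs := sqrt_lt_R0 _ Hc).
assert (Hscale : forall d, d = c + sqrt (1 - c ^ 2) * ((d - c) / sqrt (1 - c ^ 2)))
  by (intros; field; lra).
split.
- intros [Hd [M [HM Hopt]]].
  destruct (Req_dec ((d - c) / sqrt (1 - c ^ 2)) y0) as [<- | Hne].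
  + apply Hscale.
  + exfalso.
    (* The competitor that refutes optimality of [d] is the parameter given by [y0]. *)
    destruct (Hopt _ Hd0) as [M' [HM' Hle]].
    rewrite (Hscale d) in HM.
    rewrite (is_max_error_unique _ _ _ _ HM (is_max_error_scaled c _ Hc)) in Hle.
    rewrite (is_max_error_unique _ _ _ _ HM' (is_max_error_scaled c _ Hc)) in Hle.
    specialize (Hmin _ Hne); lra.
- intros ->; split; [easy |].
  exists (max_error (sqrt (1 - c ^ 2)) y0); split.
  + now apply is_max_error_scaled.
  + intros d' _; exists (max_error (sqrt (1 - c ^ 2)) ((d' - c) / sqrt (1 - c ^ 2))).
    split.
    * rewrite (Hscale d') at 1; now apply is_max_error_scaled.
    * destruct (Req_dec ((d' - c) / sqrt (1 - c ^ 2)) y0) as [-> | Hne].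
      -- lra.
      -- now apply Rlt_le, Hmin.
Qed.

(** * Monotonicity and peak of [kappa] *)

Lemma kappa_pos (y : R) : 0 < y -> 0 < kappa y.
Proof.
intros Hy; apply Rdiv_lt_0_compat; [easy | apply sqrt_lt_R0, cube_pos].
Qed.

Lemma kappa_le_id (y : R) : 0 <= y -> kappa y <= y.
Proof.
intros Hy.
assert (H : 1 <= sqrt ((1 + y ^ 2) ^ 3)).
{ rewrite <- sqrt_1 at 1; apply sqrt_le_1_alt, pow_R1_Rle; nra. }
unfold kappa; apply Rle_div_l; nra.
Qed.

(** Squaring removes the roots, so comparisons of [kappa] become polynomial inequalities in [y ^ 2]
    and [z ^ 2]. *)
Lemma kappa_lt (y z : R) : 0 <= y -> 0 < z ->
  y ^ 2 * (1 + z ^ 2) ^ 3 < z ^ 2 * (1 + y ^ 2) ^ 3 -> kappa y < kappa z.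
Proof.
intros Hy Hz H.
assert (Ha := sqrt_lt_R0 _ (cube_pos y)).
assert (Hb := sqrt_lt_R0 _ (cube_pos z)).
assert (Ea := pow2_sqrt _ (Rlt_le _ _ (cube_pos y))).
assert (Eb := pow2_sqrt _ (Rlt_le _ _ (cube_pos z))).
unfold kappa.
set (a := sqrt ((1 + y ^ 2) ^ 3)) in *.
set (b := sqrt ((1 + z ^ 2) ^ 3)) in *.
rewrite <- Ea, <- Eb in H.
assert (Hlt : y * b < z * a).
{ apply Rsqr_incrst_0; unfold Rsqr; nra. }
apply Rlt_div_l; [easy |].
replace (z / b * a) with (z * a / b) by (field; lra).
now apply Rlt_div_r.
Qed.

Lemma half_sqrt2_sq : (sqrt 2 / 2) ^ 2 = / 2.
Proof.
assert (H := pow2_sqrt 2 ltac:(lra)).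
replace ((sqrt 2 / 2) ^ 2) with (sqrt 2 ^ 2 / 4) by field; lra.
Qed.

Lemma half_sqrt2_pos : 0 < sqrt 2 / 2.
Proof. generalize Rlt_sqrt2_0; lra. Qed.

Lemma kappa_increasing (y z : R) :
  0 <= y -> y < z -> z <= sqrt 2 / 2 -> kappa y < kappa z.
Proof.
intros Hy Hyz Hz.
assert (Hz2 : z ^ 2 <= / 2).
{ rewrite <- half_sqrt2_sq; apply pow_incr; lra. }
assert (Hyz2 : y ^ 2 < z ^ 2) by nra.
assert (Hy2 : 0 <= y ^ 2) by apply pow2_ge_0.
apply kappa_lt; [easy | lra |].
set (u := y ^ 2) in *; set (v := z ^ 2) in *.
(* The second factor is positive because [u * v <= / 4] and, as [u < v <= / 2], [3 + u + v < 4]. *)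
assert (H : v * (1 + u) ^ 3 - u * (1 + v) ^ 3
            = (v - u) * (1 - u * v * (3 + u + v))) by ring.
assert (Huv : 0 <= u * v <= / 4) by (split; nra).
assert (0 < 1 - u * v * (3 + u + v)) by nra.
assert (0 < (v - u) * (1 - u * v * (3 + u + v)))
  by (apply Rmult_lt_0_compat; lra).
lra.
Qed.

Lemma kappa_lt_max (y : R) :
  0 <= y -> y <> sqrt 2 / 2 -> kappa y < kappa (sqrt 2 / 2).
Proof.
intros Hy Hne.
assert (Hp := half_sqrt2_pos).
apply kappa_lt; [easy | easy |].
assert (Hne2 : y ^ 2 <> / 2).
{ rewrite <- half_sqrt2_sq; intros H; apply Hne.
  assert (H' : (y - sqrt 2 / 2) * (y + sqrt 2 / 2) = 0) by lra.
  apply Rmult_integral in H'; lra. }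
assert (Hy2 : 0 <= y ^ 2) by apply pow2_ge_0.
rewrite half_sqrt2_sq.
set (u := y ^ 2) in *.
(* The double root at [u = / 2] handles both sides of the peak at once, without derivatives. *)
assert (H : / 2 * (1 + u) ^ 3 - u * (1 + / 2) ^ 3
            = / 2 * (u - / 2) ^ 2 * (u + 4)) by field.
assert (0 < (u - / 2) ^ 2) by (apply pow2_gt_0; lra).
assert (0 < / 2 * (u - / 2) ^ 2 * (u + 4)) by nra.
lra.
Qed.

(** * The peak value and the critical [c] *)

Lemma kappa_max : kappa (sqrt 2 / 2) = 2 * sqrt 3 / 9.
Proof.
unfold kappa; rewrite half_sqrt2_sq.
assert (H2 := pow2_sqrt 2 ltac:(lra)).
assert (H3 := pow2_sqrt 3 ltac:(lra)).
assert (P2 := Rlt_sqrt2_0).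
assert (P3 : 0 < sqrt 3) by (apply sqrt_lt_R0; lra).
(* Both are 27/8; the square form lets the outer root be extracted. *)
replace ((1 + / 2) ^ 3) with ((3 * sqrt 3 * sqrt 2 / 4) ^ 2).
2:{ replace ((3 * sqrt 3 * sqrt 2 / 4) ^ 2)
      with (9 * sqrt 3 ^ 2 * sqrt 2 ^ 2 / 16) by field.
    rewrite H2, H3; field. }
rewrite sqrt_pow2 by nra.
apply (Rmult_eq_reg_r (9 * sqrt 3)); [| lra].
replace (2 * sqrt 3 / 9 * (9 * sqrt 3)) with (2 * sqrt 3 ^ 2) by field.
rewrite H3; field; split; lra.
Qed.

(** The right side says that at the peak [y / s - 1] does not exceed [1 - kappa y / s]. Squaring it
    and solving for [c] in the case of equality yields [c_crit]. *)
Lemma le_c_crit_iff (c : R) : 0 <= c < 1 ->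
  (c <= c_crit <->
   sqrt 2 / 2 + kappa (sqrt 2 / 2) <= 2 * sqrt (1 - c ^ 2)).
Proof.
intros Hc; rewrite kappa_max.
assert (H2 := pow2_sqrt 2 ltac:(lra)).
assert (H3 := pow2_sqrt 3 ltac:(lra)).
assert (H6 := pow2_sqrt 6 ltac:(lra)).
assert (P2 := Rlt_sqrt2_0).
assert (P3 : 0 < sqrt 3) by (apply sqrt_lt_R0; lra).
assert (P6 : 0 < sqrt 6) by (apply sqrt_lt_R0; lra).
(* This makes the radicand [181 - 12 * sqrt 6] in [c_crit] positive. *)
assert (B6 : sqrt 6 < 3) by nra.
assert (E6 : sqrt 2 * sqrt 3 = sqrt 6)
  by (rewrite <- sqrt_mult by lra; f_equal; lra).
assert (Hcr : c_crit ^ 2 = (181 - 12 * sqrt 6) / 216).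
{ unfold c_crit.
  rewrite Rpow_mult_distr, pow2_sqrt by lra.
  replace ((sqrt 6 / 36) ^ 2) with (sqrt 6 ^ 2 / 1296) by field.
  rewrite H6; field. }
assert (Pcr : 0 <= c_crit).
{ unfold c_crit; apply Rmult_le_pos; [lra | apply sqrt_pos]. }
assert (Hsum : (sqrt 2 / 2 + 2 * sqrt 3 / 9) ^ 2 = 4 * (1 - c_crit ^ 2)).
{ rewrite Hcr.
  replace ((sqrt 2 / 2 + 2 * sqrt 3 / 9) ^ 2)
    with (sqrt 2 ^ 2 / 4 + 2 * (sqrt 2 * sqrt 3) / 9 + 4 * sqrt 3 ^ 2 / 81)
    by field.
  rewrite H2, H3, E6; field. }
assert (Hs2 : sqrt (1 - c ^ 2) ^ 2 = 1 - c ^ 2) by (apply pow2_sqrt; nra).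
assert (Hs := sqrt_pos (1 - c ^ 2)).
set (s := sqrt (1 - c ^ 2)) in *.
set (w := sqrt 2 / 2 + 2 * sqrt 3 / 9) in *.
assert (Hw : 0 < w) by (unfold w; lra).
split; intros H; apply Rsqr_incr_0; unfold Rsqr; nra.
Qed.

(** * Minimizing the maximal error *)

Lemma max_error_nonpos (s y : R) : 0 < s -> y <= 0 -> 1 <= max_error s y.
Proof.
intros Hs Hy.
apply Rle_trans with (2 := Rmax_l _ _), Rle_trans with (2 := Rle_abs _).
assert (0 < / s) by now apply Rinv_0_lt_compat.
unfold Rdiv; nra.
Qed.

(** As [kappa y <= y], the error at [t = 0] is the smaller one, so only its negative and the error
    at [t = 1] can dominate. *)
Lemma max_error_nonneg (s y : R) : 0 < s -> 0 <= y ->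
  max_error s y = Rmax (y / s - 1) (1 - kappa y / s).
Proof.
intros Hs Hy.
assert (H : kappa y / s <= y / s).
{ apply Rmult_le_compat_r; [now apply Rlt_le, Rinv_0_lt_compat |].
  now apply kappa_le_id. }
unfold max_error, Rmax, Rabs.
repeat destruct Rcase_abs; repeat destruct Rle_dec; lra.
Qed.

(** By hypothesis the branch [1 - kappa y / s] dominates at the peak, and for any other positive [y]
    this branch alone is already larger. *)
Lemma max_error_minimized_at_peak (s : R) : 0 < s ->
  sqrt 2 / 2 + kappa (sqrt 2 / 2) <= 2 * s ->
  forall y, y <> sqrt 2 / 2 -> max_error s (sqrt 2 / 2) < max_error s y.
Proof.
intros Hs Hle y Hne.
assert (Hp := half_sqrt2_pos).
assert (His : 0 < / s) by now apply Rinv_0_lt_compat.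
assert (Hk := kappa_pos _ Hp).
rewrite (max_error_nonneg s (sqrt 2 / 2)) by lra.
rewrite Rmax_right.
2:{ assert (H : (sqrt 2 / 2 + kappa (sqrt 2 / 2)) / s <= 2)
      by (apply Rle_div_l; lra).
    rewrite Rdiv_plus_distr in H; lra. }
destruct (Rle_or_lt y 0) as [Hy | Hy].
- apply Rlt_le_trans with (2 := max_error_nonpos s y Hs Hy).
  unfold Rdiv; nra.
- rewrite max_error_nonneg by lra.
  apply Rlt_le_trans with (2 := Rmax_r _ _).
  assert (H := kappa_lt_max y ltac:(lra) Hne).
  unfold Rdiv; nra.
Qed.

(** The equation makes both branches equal at [y0]. For positive [y] below [y0] the decreasing
    branch exceeds that value, above [y0] the increasing one does. *)
Lemma max_error_minimized_at_crossing (s y0 : R) : 0 < s ->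
  0 < y0 <= sqrt 2 / 2 -> y0 + kappa y0 = 2 * s ->
  forall y, y <> y0 -> max_error s y0 < max_error s y.
Proof.
intros Hs [Hp Hy0] Heq y Hne.
assert (His : 0 < / s) by now apply Rinv_0_lt_compat.
assert (Hk := kappa_pos _ Hp).
assert (E : y0 / s - 1 = 1 - kappa y0 / s).
{ replace (kappa y0) with (2 * s - y0) by lra; field; lra. }
rewrite (max_error_nonneg s y0), Rmax_right by lra.
destruct (Rle_or_lt y 0) as [Hy | Hy].
- apply Rlt_le_trans with (2 := max_error_nonpos s y Hs Hy).
  unfold Rdiv; nra.
- rewrite max_error_nonneg by lra.
  destruct (Rlt_or_le y y0) as [Hlt | Hge].
  + apply Rlt_le_trans with (2 := Rmax_r _ _).
    assert (H := kappa_increasing y y0 ltac:(lra) Hlt Hy0).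
    unfold Rdiv; nra.
  + apply Rlt_le_trans with (2 := Rmax_l _ _).
    rewrite <- E; unfold Rdiv; nra.
Qed.

(** * Existence and uniqueness of the crossing *)

Lemma kappa_continuous : continuity kappa.
Proof.
intros y; unfold kappa.
apply continuity_pt_div.
- apply derivable_continuous_pt, derivable_pt_id.
- apply (continuity_pt_comp (fun x => (1 + x ^ 2) ^ 3) sqrt).
  + apply derivable_continuous_pt; reg.
  + apply continuity_pt_sqrt, Rlt_le, cube_pos.
- apply Rgt_not_eq, sqrt_lt_R0, cube_pos.
Qed.

Lemma crossing_exists (s : R) : 0 < s ->
  2 * s < sqrt 2 / 2 + kappa (sqrt 2 / 2) ->
  exists y0, 0 < y0 <= sqrt 2 / 2 /\ y0 + kappa y0 = 2 * s.
Proof.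
intros Hs Hlt.
assert (Hp := half_sqrt2_pos).
assert (K0 : kappa 0 = 0) by (unfold kappa, Rdiv; ring).
destruct (IVT (fun y => y + kappa y - 2 * s) 0 (sqrt 2 / 2)) as [y0 [Hy0 E]].
- intros y; apply continuity_pt_minus; [apply continuity_pt_plus |].
  + apply derivable_continuous_pt, derivable_pt_id.
  + apply kappa_continuous.
  + apply continuity_pt_const; now intros ? ?.
- easy.
- rewrite K0; lra.
- lra.
- exists y0; split; [| lra].
  split; [| lra].
  (* The intermediate value theorem allows [y0 = 0], which would force [2 * s = 0]. *)
  destruct (Req_dec y0 0) as [-> | H]; [rewrite K0 in E; lra | lra].
Qed.

Lemma balanced_scaled (c y : R) : 0 < 1 - c ^ 2 ->
  balanced c (c + sqrt (1 - c ^ 2) * y) <->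
  0 <= y <= sqrt 2 / 2 /\ y + kappa y = 2 * sqrt (1 - c ^ 2).
Proof.
intros Hc.
assert (Hs := sqrt_lt_R0 _ Hc).
unfold balanced, d_e; rewrite !e2_scaled by easy.
rewrite Rmult_1_r; fold (kappa y).
replace ((1 + (y * 0) ^ 2) ^ 3) with 1 by ring.
rewrite sqrt_1, Rdiv_1_r.
set (s := sqrt (1 - c ^ 2)) in *.
split.
- intros [[H0 H1] E]; split; [split; nra |].
  apply (Rmult_eq_reg_r (/ s)); [| apply Rinv_neq_0_compat; lra].
  replace (2 * s * / s) with 2 by (field; lra).
  unfold Rdiv in E; lra.
- intros [[H0 H1] E]; split; [split; nra |].
  replace (kappa y) with (2 * s - y) by lra; field; lra.
Qed.

(** On the admissible range [y + kappa y] is strictly increasing, so it takes the value [2 * s] at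
    most once. *)
Lemma balanced_unique (c y y' : R) : 0 < 1 - c ^ 2 ->
  balanced c (c + sqrt (1 - c ^ 2) * y) ->
  balanced c (c + sqrt (1 - c ^ 2) * y') -> y = y'.
Proof.
intros Hc Hy Hy'.
apply balanced_scaled in Hy; [| easy].
apply balanced_scaled in Hy'; [| easy].
destruct (Rtotal_order y y') as [H | [H | H]]; [| easy |].
- assert (K := kappa_increasing y y'); lra.
- assert (K := kappa_increasing y' y); lra.
Qed.

Theorem theorem3p2 : forall c : R, 0 <= c < 1 ->
  (forall d t : R, 0 < d -> -1 <= t <= 1 ->
     e2 c t d =
       1 + sqrt (1 - c ^ 2) * (c - d)
           / sqrt ((1 - c ^ 2 + (c - d) ^ 2 * t ^ 2) ^ 3)) /\
  (c <= c_crit ->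
     forall d : R, optimal_parameter c d <-> d = d_e c) /\
  (c > c_crit ->
     (exists! d : R, balanced c d) /\
     (forall d : R, optimal_parameter c d <-> balanced c d)).
Proof.
intros c Hc.
assert (Hc2 : 0 < 1 - c ^ 2) by nra.
assert (Hs := sqrt_lt_R0 _ Hc2).
assert (Hp := half_sqrt2_pos).
assert (Hcrit := le_c_crit_iff c Hc).
split; [| split].
- intros d t _ _; apply e2_explicit; lra.
- intros Hle d.
  replace (d_e c) with (c + sqrt (1 - c ^ 2) * (sqrt 2 / 2))
    by (unfold d_e; ring).
  apply optimal_iff_strict_minimizer; [easy | nra |].
  apply max_error_minimized_at_peak; [easy | now apply Hcrit].
- intros Hgt.
  destruct (crossing_exists (sqrt (1 - c ^ 2)) Hs) as [y0 [Hy0 E]].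
  { apply Rnot_le_lt; intros H; apply Hcrit in H; lra. }
  assert (Hbal : balanced c (c + sqrt (1 - c ^ 2) * y0)).
  { apply balanced_scaled; [easy | split; [lra | easy]]. }
  assert (Huniq : forall d, balanced c d -> c + sqrt (1 - c ^ 2) * y0 = d).
  { intros d Hd.
    assert (Ed : d = c + sqrt (1 - c ^ 2) * ((d - c) / sqrt (1 - c ^ 2)))
      by (field; lra).
    rewrite Ed in Hd |- *.
    now rewrite (balanced_unique c y0 _ Hc2 Hbal Hd). }
  split.
  + exists (c + sqrt (1 - c ^ 2) * y0); now split.
  + intros d.
    rewrite (optimal_iff_strict_minimizer c y0); [| easy | nra |].
    * split; [now intros -> | intros H; symmetry; now apply Huniq].
    * now apply max_error_minimized_at_crossing.
Qed.
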